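(* For every Boolean semialgebra $H$ there are a set $\tilde H$ and a homomorphism of Boolean semialgebras $\iota:H\to\mathcal P^2\tilde H$ into the powerset Boolean semialgebra of $\tilde H$ that is Yoneda injective, i.e. for all $a,b\in H$, $\iota(a)\simeq\iota(b)$ implies $a\simeq b$.
   Context: For a binary relation $\sqsubset$ on a set, let $a\preccurlyeq b$ mean: for all $c$, $c\sqsubset a$ implies $c\sqsubset b$, and $b\sqsubset c$ implies $a\sqsubset c$. Let $a\simeq b$ mean $a\preccurlyeq b$ and $b\preccurlyeq a$. A Heyting semialgebra $(H,\sqsubset,0,1,\sqcap,\sqcup,\rightarrow)$ is a set with a binary relation, constants $0,1$ and binary operations such that for all $a,b,c$: (H1) $\sqsubset$ is transitive; (H2) $(a\sqcap b)\sqcap c\simeq a\sqcap(b\sqcap c)$; (H3) $0\sqsubset a\sqsubset 1$; (H4) $c\sqsubset a\sqcap b$ iff $c\sqsubset a$ and $c\sqsubset b$; $a\preccurlyeq a\sqcap a$; $a\sqcap b\preccurlyeq a$ and $a\sqcap b\preccurlyeq b$; (H5) $a\sqcup b\sqsubset c$ iff $a\sqsubset c$ and $b\sqsubset c$; $a\preccurlyeq a\sqcup b$ and $b\preccurlyeq a\sqcup b$; $a\sqcup a\preccurlyeq a$; (H6) $a\sqcap b\sqsubset c$ iff $a\sqsubset (b\rightarrow c)$; if $a\sqsubset b$ then $c\preccurlyeq a\rightarrow(b\sqcap c)$; if $a\sqsubset b$ then $(b\rightarrow c)\sqcap a\preccurlyeq c$. Write $\neg a=a\rightarrow 0$. A Boolean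 semialgebra is a Heyting semialgebra with $a\sqcup b\simeq\neg a\rightarrow b$ and $\neg a\sqcup b\simeq a\rightarrow b$ for all $a,b$. A homomorphism is a function $f$ with $f(0)=0$, $f(1)=1$, $a\sqsubset b\Rightarrow f(a)\sqsubset f(b)$, and commuting (with literal equality) with $\sqcap,\sqcup,\rightarrow$. For a set $X$, the powerset Boolean semialgebra is $\mathcal P^2X=\{(U,C):U\subseteq C\subseteq X\}$ with $0=(\emptyset,\emptyset)$, $1=(X,X)$, $(U_1,C_1)\sqcap(U_2,C_2)=(U_1\cap U_2,C_1\cap C_2)$, $(U_1,C_1)\sqcup(U_2,C_2)=(U_1\cup U_2,C_1\cup C_2)$, $(U_1,C_1)\rightarrow(U_2,C_2)=((X\setminus C_1)\cup U_2,(X\setminus U_1)\cup C_2)$, and $(U_1,C_1)\sqsubset(U_2,C_2)$ iff $C_1\subseteq U_2$. *)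

(* Defs.v *)
From HB Require Import structures.
From mathcomp Require Import all_boot.
From mathcomp Require Import boolp classical_sets.

Set Implicit Arguments.
Unset Strict Implicit.
Unset Printing Implicit Defensive.

Local Open Scope classical_set_scope.

Declare Scope semialg_scope.
Delimit Scope semialg_scope with semialg.

Reserved Notation "a ⊏ b" (at level 70, no associativity).
Reserved Notation "a ≼ b" (at level 70, no associativity).
Reserved Notation "a ≃ b" (at level 70, no associativity).
Reserved Notation "a ⊓ b" (at level 40, left associativity).
Reserved Notation "a ⊔ b" (at level 50, left associativity).
Reserved Notation "a ⇒ b" (at level 55, right associativity).
Reserved Notation "¬ a" (at level 35, right associativity).

(* Since [R] need not be reflexive, [yoneda_le R a b] does not imply [R a b]. *)
Definition yoneda_le (T : Type) (R : T -> T -> Prop) (a b : T) : Prop :=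
  forall c, (R c a -> R c b) /\ (R b c -> R a c).

Definition yoneda_eq (T : Type) (R : T -> T -> Prop) (a b : T) : Prop :=
  yoneda_le R a b /\ yoneda_le R b a.

(* Neither antisymmetry nor reflexivity of [hs_lt] is assumed: the laws hold  *)
(* only up to the equivalence [yoneda_eq] (displayed ≃), not up to equality.  *)
HB.mixin Record isHeytingSemialgebra T := {
  hs_lt : T -> T -> Prop;
  hs_bot : T;
  hs_top : T;
  hs_meet : T -> T -> T;
  hs_join : T -> T -> T;
  hs_imp : T -> T -> T;
  hs_lt_trans : forall a b c, hs_lt a b -> hs_lt b c -> hs_lt a c;
  hs_meetA : forall a b c,
    yoneda_eq hs_lt (hs_meet (hs_meet a b) c) (hs_meet a (hs_meet b c));
  hs_lt_bot : forall a, hs_lt hs_bot a;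
  hs_lt_top : forall a, hs_lt a hs_top;
  hs_lt_meet : forall a b c, hs_lt c (hs_meet a b) <-> hs_lt c a /\ hs_lt c b;
  hs_le_meetxx : forall a, yoneda_le hs_lt a (hs_meet a a);
  hs_le_meetl : forall a b, yoneda_le hs_lt (hs_meet a b) a;
  hs_le_meetr : forall a b, yoneda_le hs_lt (hs_meet a b) b;
  hs_join_lt : forall a b c, hs_lt (hs_join a b) c <-> hs_lt a c /\ hs_lt b c;
  hs_le_joinl : forall a b, yoneda_le hs_lt a (hs_join a b);
  hs_le_joinr : forall a b, yoneda_le hs_lt b (hs_join a b);
  hs_le_joinxx : forall a, yoneda_le hs_lt (hs_join a a) a;
  hs_meet_lt_imp : forall a b c, hs_lt (hs_meet a b) c <-> hs_lt a (hs_imp b c);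
  hs_le_imp_meet : forall a b c,
    hs_lt a b -> yoneda_le hs_lt c (hs_imp a (hs_meet b c));
  hs_imp_meet_le : forall a b c,
    hs_lt a b -> yoneda_le hs_lt (hs_meet (hs_imp b c) a) c
}.

#[short(type="heytingSemialgType")]
HB.structure Definition HeytingSemialgebra := { T of isHeytingSemialgebra T }.

Notation "a ⊏ b" := (hs_lt a b) : semialg_scope.
Notation "a ≼ b" := (yoneda_le hs_lt a b) : semialg_scope.
Notation "a ≃ b" := (yoneda_eq hs_lt a b) : semialg_scope.
Notation "a ⊓ b" := (hs_meet a b) : semialg_scope.
Notation "a ⊔ b" := (hs_join a b) : semialg_scope.
Notation "a ⇒ b" := (hs_imp a b) : semialg_scope.
Notation "¬ a" := (hs_imp a hs_bot) : semialg_scope.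

Local Open Scope semialg_scope.

HB.mixin Record HeytingSemialgebra_isBoolean T of HeytingSemialgebra T := {
  bs_joinE : forall a b : T, a ⊔ b ≃ (¬ a) ⇒ b;
  bs_impE : forall a b : T, (¬ a) ⊔ b ≃ a ⇒ b
}.

#[short(type="booleanSemialgType")]
HB.structure Definition BooleanSemialgebra :=
  { T of isHeytingSemialgebra T & HeytingSemialgebra_isBoolean T }.

Record semialg_homomorphism (H K : heytingSemialgType) (f : H -> K) : Prop := {
  hom_bot : f hs_bot = hs_bot;
  hom_top : f hs_top = hs_top;
  hom_lt : forall a b, a ⊏ b -> f a ⊏ f b;
  hom_meet : forall a b, f (a ⊓ b) = f a ⊓ f b;
  hom_join : forall a b, f (a ⊔ b) = f a ⊔ f b;
  hom_imp : forall a b, f (a ⇒ b) = f a ⇒ f b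
}.

Definition yoneda_injective (H K : heytingSemialgType) (f : H -> K) : Prop :=
  forall a b : H, f a ≃ f b -> a ≃ b.

(* The pairs (U, C) with U `<=` C; by proof irrelevance two such pairs are     *)
(* equal as soon as both components are.                                      *)
Record powerset2 (X : Type) : Type := Powerset2 {
  p2_lower : set X;
  p2_upper : set X;
  p2_sub : p2_lower `<=` p2_upper
}.

Section Powerset2.
Variable X : Type.
Implicit Types a b c : powerset2 X.

Definition p2_lt a b : Prop := p2_upper a `<=` p2_lower b.

Definition p2_bot : powerset2 X := Powerset2 (@subset_refl _ set0).

Definition p2_top : powerset2 X := Powerset2 (@subset_refl _ setT).

Definition p2_meet a b : powerset2 X :=
  @Powerset2 X (p2_lower a `&` p2_lower b) (p2_upper a `&` p2_upper b)
    (setISS (@p2_sub _ a) (@p2_sub _ b)).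

Definition p2_join a b : powerset2 X :=
  @Powerset2 X (p2_lower a `|` p2_lower b) (p2_upper a `|` p2_upper b)
    (setUSS (@p2_sub _ a) (@p2_sub _ b)).

Definition p2_imp a b : powerset2 X :=
  @Powerset2 X (~` p2_upper a `|` p2_lower b) (~` p2_lower a `|` p2_upper b)
    (setUSS (subsetC (@p2_sub _ a)) (@p2_sub _ b)).

Let p2_le_sub a b : p2_lower a `<=` p2_lower b -> p2_upper a `<=` p2_upper b ->
  yoneda_le p2_lt a b.
Proof.
by move=> ab1 ab2 c; split=> h; [apply: subset_trans ab1|apply: subset_trans h].
Qed.

Let p2_eq_sub a b : p2_lower a = p2_lower b -> p2_upper a = p2_upper b ->
  yoneda_eq p2_lt a b.
Proof. by move=> ab1 ab2; split; apply: p2_le_sub; rewrite ?ab1 ?ab2. Qed.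

Let p2_lt_trans a b c : p2_lt a b -> p2_lt b c -> p2_lt a c.
Proof. by move=> ab bc x /ab /(@p2_sub _ b) /bc. Qed.

Let p2_meetA a b c :
  yoneda_eq p2_lt (p2_meet (p2_meet a b) c) (p2_meet a (p2_meet b c)).
Proof. by apply: p2_eq_sub; rewrite /= setIA. Qed.

Let p2_lt_bot a : p2_lt p2_bot a. Proof. exact: sub0set. Qed.

Let p2_lt_top a : p2_lt a p2_top. Proof. exact: subsetT. Qed.

Let p2_lt_meet a b c : p2_lt c (p2_meet a b) <-> p2_lt c a /\ p2_lt c b.
Proof. by rewrite /p2_lt /= subsetI. Qed.

Let p2_le_meetxx a : yoneda_le p2_lt a (p2_meet a a).
Proof. by apply: p2_le_sub; rewrite /= setIid. Qed.

Let p2_le_meetl a b : yoneda_le p2_lt (p2_meet a b) a.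
Proof. by apply: p2_le_sub; apply: subIsetl. Qed.

Let p2_le_meetr a b : yoneda_le p2_lt (p2_meet a b) b.
Proof. by apply: p2_le_sub; apply: subIsetr. Qed.

Let p2_join_lt a b c : p2_lt (p2_join a b) c <-> p2_lt a c /\ p2_lt b c.
Proof. by rewrite /p2_lt /= subUset. Qed.

Let p2_le_joinl a b : yoneda_le p2_lt a (p2_join a b).
Proof. by apply: p2_le_sub; apply: subsetUl. Qed.

Let p2_le_joinr a b : yoneda_le p2_lt b (p2_join a b).
Proof. by apply: p2_le_sub; apply: subsetUr. Qed.

Let p2_le_joinxx a : yoneda_le p2_lt (p2_join a a) a.
Proof. by apply: p2_le_sub; rewrite /= setUid. Qed.

Let p2_meet_lt_imp a b c : p2_lt (p2_meet a b) c <-> p2_lt a (p2_imp b c).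
Proof.
split=> h x /=.
- by move=> ax; have [bx|nbx] := EM (p2_upper b x); [right; apply: h|left].
- by move=> [/h[]].
Qed.

Let p2_le_imp_meet a b c :
  p2_lt a b -> yoneda_le p2_lt c (p2_imp a (p2_meet b c)).
Proof.
move=> ab; apply: p2_le_sub => x /= cx.
- have [ax|nax] := EM (p2_upper a x); last by left.
  by right; split=> //; apply: ab.
- have [ax|nax] := EM (p2_lower a x); last by left.
  by right; split=> //; apply/p2_sub/ab/p2_sub.
Qed.

Let p2_imp_meet_le a b c :
  p2_lt a b -> yoneda_le p2_lt (p2_meet (p2_imp b c) a) c.
Proof.
move=> ab; apply: p2_le_sub => x /= [[nbx|//] ax]; case: nbx.
- exact/p2_sub/ab/p2_sub.
- exact: ab.
Qed.

HB.instance Definition _ := isHeytingSemialgebra.Build (powerset2 X)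
  p2_lt_trans p2_meetA p2_lt_bot p2_lt_top p2_lt_meet p2_le_meetxx p2_le_meetl
  p2_le_meetr p2_join_lt p2_le_joinl p2_le_joinr p2_le_joinxx p2_meet_lt_imp
  p2_le_imp_meet p2_imp_meet_le.

Let p2_joinE a b : a ⊔ b ≃ (¬ a) ⇒ b.
Proof. by apply: p2_eq_sub; rewrite /= setU0 setCK. Qed.

Let p2_impE a b : (¬ a) ⊔ b ≃ a ⇒ b.
Proof. by apply: p2_eq_sub; rewrite /= setU0. Qed.

HB.instance Definition _ := HeytingSemialgebra_isBoolean.Build (powerset2 X)
  p2_joinE p2_impE.

End Powerset2.

(* Main.v *)
(** The powerset semialgebra of a point is the three-element Kleene chain, so
    the points of the representing set are the homomorphisms from [H] to it.
    Such a homomorphism is determined by the set [F] of elements with value 1,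
    which is a prime filter never containing both [a] and [¬ a]; the elements
    with value 0 are those whose negation lies in [F].  If [c ⊏ b] fails, put
    [d = c ⇒ b], so that [hs_top ⊏ d] fails.  The elements [x] all of whose
    ⊏-predecessors precede [d] form an ideal that contains [d] and every
    [a ⊓ ¬ a] but not [hs_top]; a filter maximal among those disjoint from this
    ideal is prime and consistent, and avoids both [¬ c] and [b].  Hence [iota]
    reflects ⊏, which gives Yoneda injectivity. *)

Require Import Defs.
From HB Require Import structures.
From mathcomp Require Import all_boot.
From mathcomp Require Import boolp classical_sets.

Set Implicit Arguments.
Unset Strict Implicit.
Unset Printing Implicit Defensive.

Local Open Scope classical_set_scope.
Local Open Scope semialg_scope.

(** * Commutation, cut and negation in Heyting semialgebras *)

Section HeytingTheory.
Variable H : heytingSemialgType.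
Implicit Types a b c d : H.

Lemma meet_ltl a b c : a ⊏ c -> a ⊓ b ⊏ c.
Proof. exact: (hs_le_meetl a b c).2. Qed.

Lemma meet_ltr a b c : b ⊏ c -> a ⊓ b ⊏ c.
Proof. exact: (hs_le_meetr a b c).2. Qed.

(* (H4) only makes [c ⊏ a ⊓ b] symmetric in [a] and [b]; on the other side,
   commutativity comes from b ⊓ a ≼ (b ⊓ a) ⊓ (b ⊓ a) ≼ a ⊓ (b ⊓ a) ≃
   (a ⊓ b) ⊓ a ≼ a ⊓ b. *)
Lemma meetC_lt a b c : a ⊓ b ⊏ c -> b ⊓ a ⊏ c.
Proof.
move=> abc; apply: (hs_le_meetxx (b ⊓ a) c).2.
apply/hs_meet_lt_imp/meet_ltr/hs_meet_lt_imp.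
exact/((hs_meetA a b a).2 c).2/meet_ltl.
Qed.

Lemma meetAC_lt a b c d : (a ⊓ b) ⊓ c ⊏ d -> (a ⊓ c) ⊓ b ⊏ d.
Proof.
move=> /((hs_meetA a b c).2 d).2 /meetC_lt /hs_meet_lt_imp /meetC_lt.
by move=> /(hs_meet_lt_imp _ _ _).2 /meetC_lt /((hs_meetA a c b).1 d).2.
Qed.

(** Residuation gives [a ⊏ c ⇒ b], so [c ⊏ c ⇒ b] by transitivity; then [c ⊓ c ⊏ b] contracts by
    [c ≼ c ⊓ c]. *)
Lemma lt_cut a b c : c ⊏ a -> c ⊓ a ⊏ b -> c ⊏ b.
Proof.
move=> ca /meetC_lt /hs_meet_lt_imp acb; apply: (hs_le_meetxx c b).2.
exact/hs_meet_lt_imp/(hs_lt_trans _ _ _ ca).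
Qed.

Lemma top_lt_imp a b : hs_top ⊏ a ⇒ b <-> a ⊏ b.
Proof.
split=> [/hs_meet_lt_imp /meetC_lt|ab]; first exact/lt_cut/hs_lt_top.
exact/hs_meet_lt_imp/meet_ltr.
Qed.

Lemma lt_negC a b : a ⊏ ¬ b -> b ⊏ ¬ a.
Proof. by move=> /hs_meet_lt_imp /meetC_lt /hs_meet_lt_imp. Qed.

Lemma lt_contradiction a b c : c ⊏ a -> c ⊏ ¬ a -> c ⊏ b.
Proof.
move=> ca /hs_meet_lt_imp cna; apply: (hs_lt_trans _ hs_bot); last exact: hs_lt_bot.
exact: lt_cut ca cna.
Qed.

End HeytingTheory.

(** * Boolean laws seen from below *)

Section BooleanTheory.
Variable H : booleanSemialgType.
Implicit Types a b c d : H.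

Lemma lt_joinE a b c : c ⊏ a ⊔ b <-> c ⊓ ¬ a ⊏ b.
Proof.
rewrite hs_meet_lt_imp.
by split; [apply: ((bs_joinE a b).1 c).1|apply: ((bs_joinE a b).2 c).1].
Qed.

Lemma lt_imp_join a b c : c ⊏ a ⇒ b <-> c ⊏ (¬ a) ⊔ b.
Proof. by split; [apply: ((bs_impE a b).2 c).1|apply: ((bs_impE a b).1 c).1]. Qed.

(** If [c ⊓ ¬ a ⊏ hs_bot], then [c ⊓ ¬ a ⊏ a], that is [c ⊏ a ⊔ a], and [a ⊔ a ≼ a]. *)
Lemma lt_negK a c : c ⊏ ¬ ¬ a <-> c ⊏ a.
Proof.
split=> [/hs_meet_lt_imp ca|ca].
- apply: (hs_le_joinxx a c).1; apply/lt_joinE.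
  exact/(hs_lt_trans _ _ _ ca)/hs_lt_bot.
- by apply/hs_meet_lt_imp/lt_joinE; apply: (hs_le_joinl a hs_bot c).1.
Qed.

(** (H5) is symmetric only for joins on the left of [⊏]. Here [c ⊏ a ⊔ b] becomes
    [(c ⊓ ¬ a) ⊓ ¬ b ⊏ hs_bot], where the negations can be swapped. *)
Lemma lt_joinC a b c : c ⊏ a ⊔ b -> c ⊏ b ⊔ a.
Proof.
move=> /lt_joinE /lt_negK /(hs_meet_lt_imp _ _ _).2 /meetAC_lt cab.
exact/lt_joinE/lt_negK/(hs_meet_lt_imp _ _ _).1.
Qed.

(** In this law and the next two, comparing predecessors is enough to transfer membership in a
    filter. *)
Lemma lt_neg_meet a b c : c ⊏ ¬ (a ⊓ b) <-> c ⊏ (¬ a) ⊔ (¬ b).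
Proof.
rewrite -lt_imp_join -!hs_meet_lt_imp.
by split=> [/((hs_meetA c a b).1 _).2|/((hs_meetA c a b).2 _).2].
Qed.

Lemma lt_neg_join a b c : c ⊏ ¬ (a ⊔ b) <-> c ⊏ (¬ a) ⊓ (¬ b).
Proof.
split=> [/lt_negC /hs_join_lt[ac bc]|/hs_lt_meet[ca cb]].
- by apply/hs_lt_meet; split; apply: lt_negC.
- by apply/lt_negC/hs_join_lt; split; apply: lt_negC.
Qed.

Lemma lt_neg_imp a b c : c ⊏ ¬ (a ⇒ b) <-> c ⊏ a ⊓ ¬ b.
Proof.
split=> [/lt_negC abc|/hs_lt_meet[ca cb]].
- have /hs_join_lt[ac bc] : (¬ a) ⊔ b ⊏ ¬ c by apply: ((bs_impE a b).1 _).2.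
  by apply/hs_lt_meet; split; [apply/lt_negK|]; apply: lt_negC.
- apply/lt_negC/((bs_impE a b).2 _).2/hs_join_lt.
  by split; apply: lt_negC => //; apply/lt_negK.
Qed.

End BooleanTheory.

(** * Filters and the existence of points *)

Section Filters.
Variable H : booleanSemialgType.
Implicit Types (a b c d f x y z : H) (F : set H).

(* Filters are closed upwards for this coarsening of ≼, for which [a ⊓ b] is an
   infimum by (H4) alone. *)
Definition lower_le a b := forall c, c ⊏ a -> c ⊏ b.

(** The empty set counts as a filter, so that Zorn's lemma also covers the empty chain. *)
Record semialg_filter F : Prop := {
  filter_meet : forall a b, F a -> F b -> F (a ⊓ b);
  filter_le : forall a b, lower_le a b -> F a -> F b
}.

Record kleene_point F : Prop := {
  point_filter : semialg_filter F;
  point_top : F hs_top;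
  point_prime : forall a b, F (a ⊔ b) -> F a \/ F b;
  point_consistent : forall a, F a -> ~ F (¬ a)
}.

Lemma filter_equiv F a b : semialg_filter F ->
  (forall c, c ⊏ a <-> c ⊏ b) -> F a <-> F b.
Proof. by move=> FF ab; split; apply: filter_le FF _ _ _ => c /ab. Qed.

Lemma filter_meetE F a b : semialg_filter F -> F (a ⊓ b) <-> F a /\ F b.
Proof.
move=> FF; split=> [Fab|[]]; last exact: filter_meet.
by split; apply: filter_le FF _ _ _ Fab => c /hs_lt_meet[].
Qed.

Lemma principal_filter a : semialg_filter (lower_le a).
Proof.
split=> [b c ab ac e ea|b c bc ab e ea]; last exact/bc/ab.
by apply/hs_lt_meet; split; [apply: ab|apply: ac].
Qed.

(** For a nonempty filter [F], this is the filter generated by [F] and [x]. *)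
Definition filter_adjoin F x : set H :=
  [set z | exists2 f, F f & lower_le (f ⊓ x) z].

Lemma filter_adjoinP F x : semialg_filter F -> semialg_filter (filter_adjoin F x).
Proof.
move=> FF; split=> [a b [f Ff fa] [g Fg gb]|a b ab [f Ff fa]].
- exists (f ⊓ g); first exact: filter_meet.
  move=> c /hs_lt_meet[/hs_lt_meet[cf cg] cx]; apply/hs_lt_meet.
  by split; [apply: fa|apply: gb]; apply/hs_lt_meet.
- by exists f => // c /fa /ab.
Qed.

Lemma sub_filter_adjoin F x : F `<=` filter_adjoin F x.
Proof. by move=> f Ff; exists f => // c /hs_lt_meet[]. Qed.

Lemma filter_adjoin_mem F x f : F f -> filter_adjoin F x x.
Proof. by move=> Ff; exists f => // c /hs_lt_meet[]. Qed.

Lemma filter_bigcup (A : set (set H)) : A `<=` semialg_filter ->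
  total_on A subset -> semialg_filter (\bigcup_(F in A) F).
Proof.
move=> AF Atot; split=> [a b [F AF' Fa] [G AG Gb]|a b ab [F AF' Fa]].
- have [FG|GF] := Atot _ _ AF' AG.
  + by exists G => //; apply: filter_meet (AF _ AG) _ _ (FG _ Fa) Gb.
  + by exists F => //; apply: filter_meet (AF _ AF') _ _ Fa (GF _ Gb).
- by exists F => //; apply: filter_le (AF _ AF') _ _ ab Fa.
Qed.

(** For [c] below both [f] and [x ⊔ y], the [y] hypothesis gives [c ⊓ ¬ x ⊏ d], hence [c ⊓ ¬ d ⊏ x];
    the [x] hypothesis then gives [c ⊓ ¬ d ⊏ d], so [c ⊏ d ⊔ d ≼ d]. *)
Lemma lower_le_join x y f d : lower_le (f ⊓ x) d -> lower_le (f ⊓ y) d ->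
  lower_le (f ⊓ (x ⊔ y)) d.
Proof.
move=> fxd fyd c /hs_lt_meet[cf /lt_joinE cxy].
have /lt_joinE /lt_joinC /lt_joinE cdx : c ⊓ ¬ x ⊏ d.
  by apply/fyd/hs_lt_meet; split=> //; apply: meet_ltl.
apply/(hs_le_joinxx d c).1/lt_joinE/fxd/hs_lt_meet.
by split=> //; apply: meet_ltl.
Qed.

Lemma exists_kleene_point d : ~ hs_top ⊏ d ->
  exists2 F, kleene_point F & ~ F d.
Proof.
move=> ntd.
pose avoiding F := semialg_filter F /\ forall x, F x -> ~ lower_le x d.
have avoidT : avoiding (lower_le hs_top).
  split; first exact: principal_filter.
  by move=> x tx xd; apply/ntd/xd/tx/hs_lt_top.
have [A AP Atot|F [[FF Fd] Fmax]] := @Zorn_bigcup _ avoiding.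
  split; first by apply: filter_bigcup => // F /AP[].
  by move=> x [F /AP[_ +] Fx]; apply.
have maxF G : avoiding G -> F `<=` G -> G `<=` F.
  by move=> aG FG; apply: contrapT => nGF; apply: (Fmax G).
(* Were [F] empty, the avoiding filter [lower_le hs_top] would extend it, and maximality would still
   put [hs_top] in [F]. *)
have Ft : F hs_top.
  have [[f Ff]|F0] := EM (exists f, F f).
    by apply: filter_le FF _ _ _ Ff => c _; apply: hs_lt_top.
  by apply: maxF avoidT _ _ _ => // x Fx; case: F0; exists x.
have adjoin x : ~ F x -> exists2 f, F f & lower_le (f ⊓ x) d.
  move=> nFx; apply: contrapT => nf; apply/nFx/(maxF (filter_adjoin F x)).
  - split; first exact: filter_adjoinP.
    move=> z [f Ff fz] zd; apply: nf; exists f => // c /fz; exact: zd.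
  - exact: sub_filter_adjoin.
  - exact: filter_adjoin_mem Ft.
exists F; last by move=> /Fd; apply.
split=> // [x y Fxy|a Fa Fna].
(* The meet [f ⊓ g] serves both [x] and [y]. *)
- apply: contrapT => /not_orP[/adjoin[f Ff fx] /adjoin[g Fg gy]].
  apply: (Fd ((f ⊓ g) ⊓ (x ⊔ y))); first by do ![apply: filter_meet].
  by apply: lower_le_join => c /hs_lt_meet[/hs_lt_meet[cf cg] cz];
    [apply: fx|apply: gy]; apply/hs_lt_meet.
- apply: (Fd (a ⊓ ¬ a)); first exact: filter_meet.
  by move=> c /hs_lt_meet[]; apply: lt_contradiction.
Qed.

End Filters.

(** * Truth tables of the connectives at a point *)

Section KleenePoint.
Variables (H : booleanSemialgType) (F : set H).
Hypothesis pF : kleene_point F.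
Implicit Types a b : H.

Let FF : semialg_filter F := point_filter pF.

Lemma point_lt_top a : hs_top ⊏ a -> F a.
Proof.
move=> ta; apply: filter_le FF _ _ _ (point_top pF) => c ct.
exact: hs_lt_trans ct ta.
Qed.

Lemma point_bot : ~ F hs_bot.
Proof.
move=> F0; apply: (point_consistent pF F0).
by apply/point_lt_top/top_lt_imp/hs_lt_bot.
Qed.

Lemma point_joinE a b : F (a ⊔ b) <-> F a \/ F b.
Proof.
split=> [|[]]; first exact: point_prime.
- by apply: filter_le FF _ _ _ => c; apply: (hs_le_joinl a b c).1.
- by apply: filter_le FF _ _ _ => c; apply: (hs_le_joinr a b c).1.
Qed.

Lemma point_impE a b : F (a ⇒ b) <-> F (¬ a) \/ F b.
Proof.
by rewrite -point_joinE; apply: filter_equiv FF _ => c; apply: lt_imp_join.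
Qed.

Lemma point_neg_meetE a b : F (¬ (a ⊓ b)) <-> F (¬ a) \/ F (¬ b).
Proof.
by rewrite -point_joinE; apply: filter_equiv FF _ => c; apply: lt_neg_meet.
Qed.

Lemma point_neg_joinE a b : F (¬ (a ⊔ b)) <-> F (¬ a) /\ F (¬ b).
Proof.
rewrite -(filter_meetE _ _ FF).
by apply: filter_equiv FF _ => c; apply: lt_neg_join.
Qed.

Lemma point_neg_impE a b : F (¬ (a ⇒ b)) <-> F a /\ F (¬ b).
Proof.
rewrite -(filter_meetE _ _ FF).
by apply: filter_equiv FF _ => c; apply: lt_neg_imp.
Qed.

End KleenePoint.

(** * The representation by points *)

Section Representation.
Variable H : booleanSemialgType.
Implicit Types a b : H.

Let X := {F : set H | kleene_point F}.

Definition point_lower a : set X := [set F | sval F a].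

(** The points at which [a] does not take the value 0. *)
Definition point_upper a : set X := [set F | ~ sval F (¬ a)].

Lemma point_lower_sub_upper a : point_lower a `<=` point_upper a.
Proof. by move=> [F pF] /=; apply: point_consistent. Qed.

Definition representation a : powerset2 X :=
  Powerset2 (@point_lower_sub_upper a).

Lemma powerset2_eq (Y : Type) (p q : powerset2 Y) :
  p2_lower p = p2_lower q -> p2_upper p = p2_upper q -> p = q.
Proof.
case: p q => [U C UC] [V D VD] /= UV CD; subst V D.
by rewrite (Prop_irrelevance UC VD).
Qed.

Lemma representation_eq a (p : powerset2 X) :
  (forall F : X, sval F a <-> p2_lower p F) ->
  (forall F : X, ~ sval F (¬ a) <-> p2_upper p F) -> representation a = p.
Proof.
move=> aU aC; apply: powerset2_eq; apply/funext => F; apply/propext.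
- exact: aU.
- exact: aC.
Qed.

Lemma representation_homomorphism : semialg_homomorphism representation.
Proof.
split=> [||a b ab|a b|a b|a b].
- apply: representation_eq => -[F pF] /=; split=> //; first exact: point_bot.
  by case; apply/(point_lt_top pF)/top_lt_imp/hs_lt_bot.
- apply: representation_eq => -[F pF] /=; split=> // _; first exact: point_top pF.
  exact/(point_consistent pF)/(point_top pF).
- have sub : p2_lt (representation a) (representation b).
    move=> [F pF] nFa; have /(point_impE pF)[] // : F (a ⇒ b).
    by apply/(point_lt_top pF)/top_lt_imp.
  exact: sub.
- apply: representation_eq => -[F pF] /=.
  + exact/filter_meetE/point_filter.
  + by rewrite (point_neg_meetE pF) not_orP.
- apply: representation_eq => -[F pF] /=; first exact: point_joinE.
  by rewrite (point_neg_joinE pF) not_andP.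
- apply: representation_eq => -[F pF] /=.
  + by rewrite (point_impE pF) /setU /setC /point_upper /= notK.
  + by rewrite (point_neg_impE pF) not_andP.
Qed.

Lemma representation_reflects_lt a b : representation a ⊏ representation b -> a ⊏ b.
Proof.
move=> ab; apply: contrapT => nab.
have [F pF nF] : exists2 F, kleene_point F & ~ F (a ⇒ b).
  by apply: exists_kleene_point => /top_lt_imp.
apply: nF; apply/(point_impE pF).
have [Fna|nFna] := EM (F (¬ a)); first by left.
by right; apply: (ab (exist _ F pF)).
Qed.

(** Testing [≼] against images [representation c] suffices, since [⊏] is preserved and reflected. *)
Lemma representation_injective : yoneda_injective representation.
Proof.
have mono := hom_lt representation_homomorphism.
have le a b : representation a ≼ representation b -> a ≼ b.
  move=> ab c; split=> [/mono /(ab _).1|/mono /(ab _).2];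
    exact: representation_reflects_lt.
by move=> a b [/le ab /le ba].
Qed.

End Representation.

Theorem theorem27 (H : booleanSemialgType) :
  exists (X : Type) (iota : H -> powerset2 X),
    semialg_homomorphism iota /\ yoneda_injective iota.
Proof.
exists {F : set H | kleene_point F}, (@representation H).
by split; [apply: representation_homomorphism|apply: representation_injective].
Qed.
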